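(* Let $(M,d)$ be a complete pointed metric space and let $\mu$ be a positive Radon measure on $\beta\widetilde{M}$ that is $\preccurlyeq$-minimal and concentrated on $\mathcal{R}^+:=\{\zeta\in\beta\widetilde{M}: p_1(\zeta),p_2(\zeta)\in\mathcal{R}(M),\ p_1(\zeta)\ne p_2(\zeta)\}$. Then the marginals are mutually singular: $(p_1)_\sharp\mu\perp(p_2)_\sharp\mu$.
   Context: $\widetilde{M}=\{(x,y)\in M\times M:x\ne y\}$, $\beta\widetilde{M}$ its Stone–Čech compactification; Radon measures on it are identified with $C(\beta\widetilde{M})^*$. $M^u$ is the uniform (Samuel) compactification of $M$; $p_1,p_2:\beta\widetilde{M}\to M^u$ are the continuous extensions of $(x,y)\mapsto x$, $(x,y)\mapsto y$, and $(p_i)_\sharp\mu$ denotes the pushforward measure on $M^u$. $\mathcal{R}(M)=\{\xi\in M^u:\overline{d_0}(\xi)<\infty\}$, where $\overline{d_0}:M^u\to[0,\infty]$ is the continuous extension of $x\mapsto d(x,0)$ ($0$ the base point). $G$ is the set of $g\in C(\beta\widetilde{M})$ with $d(x,y)g(x,y)\le d(x,u)g(x,u)+d(u,y)g(u,y)$ for all distinct $x,u,y\in M$; for positive Radon measures, $\mu\preccurlyeq\nu$ iff $\int g\,d\mu\le\int g\,d\nu$ for all $g\in G$; $\mu$ is $\preccurlyeq$-minimal if every positive $\nu\preccurlyeq\mu$ satisfies $\mu\preccurlyeq\nu$. Throughout, $M$ has at least three distinct points. *)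

(* Defs.v *)
From HB Require Import structures.
From mathcomp Require Import all_boot all_order all_algebra.
From mathcomp Require Import all_classical all_reals all_analysis.
Set Implicit Arguments. Unset Strict Implicit. Unset Printing Implicit Defensive.
Import Order.TTheory GRing.Theory Num.Theory.
Import numFieldNormedType.Exports.
Local Open Scope classical_set_scope.
Local Open Scope ring_scope.

Section Defs.
Variable R : realType.

Definition is_metric (M : Type) (d : M -> M -> R) : Prop :=
  (forall x y, d x y = 0 <-> x = y) /\
  (forall x y, d x y = d y x) /\
  (forall x y z, d x z <= d x y + d y z).

Definition complete_metric (M : Type) (d : M -> M -> R) : Prop :=
  forall u : nat -> M,
    (forall e, 0 < e -> exists N, forall m n, (N <= m)%N -> (N <= n)%N ->
        d (u m) (u n) < e) ->
    exists l, forall e, 0 < e -> exists N, forall n, (N <= n)%N -> d (u n) l < e.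

Definition Mt (M : Type) := {p : M * M | p.1 <> p.2}.
Definition mkMt (M : Type) (x y : M) (h : x <> y) : Mt M :=
  exist (fun p : M * M => p.1 <> p.2) (x, y) h.

Definition mt_continuous (M : Type) (d : M -> M -> R) (f : Mt M -> R) : Prop :=
  forall z : Mt M, forall e, 0 < e -> exists2 del, 0 < del &
    forall z' : Mt M, d (proj1_sig z).1 (proj1_sig z').1
                      + d (proj1_sig z).2 (proj1_sig z').2 < del ->
      `|f z - f z'| < e.

Definition unif_continuous (M : Type) (d : M -> M -> R) (f : M -> R) : Prop :=
  forall e, 0 < e -> exists2 del, 0 < del &
    forall x y, d x y < del -> `|f x - f y| < e.

Definition bounded_fun (T : Type) (f : T -> R) : Prop :=
  exists C : R, forall t, `|f t| <= C.

Definition is_stone_cech (M : Type) (d : M -> M -> R)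
    (K : topologicalType) (iota : Mt M -> K) : Prop :=
  [/\ compact [set: K], hausdorff_space K,
      closure (range iota) = [set: K],
      (forall F : K -> R, continuous F -> mt_continuous d (F \o iota)) &
      (forall f : Mt M -> R, mt_continuous d f -> bounded_fun f ->
         exists2 F : K -> R, continuous F & forall z, F (iota z) = f z)].

Definition is_samuel (M : Type) (d : M -> M -> R)
    (L : topologicalType) (j : M -> L) : Prop :=
  [/\ compact [set: L], hausdorff_space L,
      closure (range j) = [set: L],
      (forall F : L -> R, continuous F -> unif_continuous d (F \o j)) &
      (forall f : M -> R, unif_continuous d f -> bounded_fun f ->
         exists2 F : L -> R, continuous F & forall x, F (j x) = f x)].

Definition BorelT (K : ptopologicalType) := g_sigma_algebraType (@open K).

Definition radon (K : ptopologicalType) (mu : set (BorelT K) -> \bar R) : Prop :=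
  (mu [set: BorelT K] < +oo)%E /\
  forall A : set (BorelT K), measurable A ->
    mu A = ereal_sup [set mu C | C in [set C : set K | compact C /\ C `<=` A]].

Definition in_G (M : Type) (d : M -> M -> R) (K : topologicalType)
    (iota : Mt M -> K) (g : K -> R) : Prop :=
  continuous g /\
  forall (x u y : M) (hxu : x <> u) (huy : u <> y) (hxy : x <> y),
    d x y * g (iota (mkMt hxy)) <=
    d x u * g (iota (mkMt hxu)) + d u y * g (iota (mkMt huy)).

Definition mprec (M : Type) (d : M -> M -> R) (K : ptopologicalType)
    (iota : Mt M -> K) (mu nu : {measure set (BorelT K) -> \bar R}) : Prop :=
  forall g : K -> R, in_G d iota g ->
    (\int[mu]_x (g x)%:E <= \int[nu]_x (g x)%:E)%E.

Definition prec_minimal (M : Type) (d : M -> M -> R) (K : ptopologicalType)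
    (iota : Mt M -> K) (mu : {measure set (BorelT K) -> \bar R}) : Prop :=
  forall nu : {measure set (BorelT K) -> \bar R}, radon nu ->
    mprec d iota nu mu -> mprec d iota mu nu.

Definition RM (L : Type) (d0 : L -> \bar R) : set L := [set xi | (d0 xi < +oo)%E].

Definition Rplus (K L : Type) (p1 p2 : K -> L) (d0 : L -> \bar R) : set K :=
  [set z | RM d0 (p1 z) /\ RM d0 (p2 z) /\ p1 z <> p2 z].

Definition mutually_singular (L : ptopologicalType)
    (nu1 nu2 : set (BorelT L) -> \bar R) : Prop :=
  exists A : set (BorelT L), [/\ measurable A, nu1 A = 0%E & nu2 (~` A) = 0%E].

End Defs.

(* Main.v *)
(** Suppose mass travelling into a point and mass travelling out of the same
    point were both present.  Merging them through the triangle inequality should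
    produce a strictly smaller measure, but in the compactification the merged
    measure is awkward to construct, and a dual argument avoids it.  For continuous
    [f] put [p f := inf {\int g dmu | g in G, f <= g}], a sublinear functional whose
    linear minorants are the positive Radon measures below [mu].  Let [g0] in [G]
    extend [(x, y) |-> 1 / (1 + d x y)].  Hahn-Banach and Riesz give a measure
    [nu] below [mu] with [\int g0 dnu = - p (- g0)], so minimality yields
    [g_n] in [G] with [g_n >= - g0] and [\int (g_n + g0) dmu] summable, hence
    [g_n --> - g0] almost everywhere.  If [z1], [z2] are points of convergence with
    [p2 z1 = p1 z2], approximate them by pairs [(x, u)], [(u', y)] with [u] close to
    [u'].  Then [d x y * g_n (x, y)] is at most about
    [- (d x u * g0 (x, u) + d u y * g0 (u, y))], which is strictly below
    [- d x y * g0 (x, y)] because [t / (1 + t)] is strictly subadditive; this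
    contradicts [g_n >= - g0].  So a set of full measure has disjoint images under
    [p1] and [p2], and inner regularity makes it sigma-compact. *)

Require Import Defs.
From HB Require Import structures.
From mathcomp Require Import all_boot all_order all_algebra.
From mathcomp Require Import all_classical all_reals all_analysis.
From mathcomp Require Import measurable_realfun ring lra.
Set Implicit Arguments.
Unset Strict Implicit.
Unset Printing Implicit Defensive.
Import Order.TTheory GRing.Theory Num.Theory.
Import numFieldNormedType.Exports.
Local Open Scope classical_set_scope.
Local Open Scope ring_scope.

(** * Hahn-Banach *)

(** A subspace is kept as a set in an ambient module, so that the continuous functions can be used
    inside the module of all functions. *)
Definition lin_closed (R : realType) (V : lmodType R) (D : set V) : Prop :=
  (exists x, D x) /\ forall a x y, D x -> D y -> D (a *: x + y).

(** Scaling is only an inequality, which is what infima satisfy directly; [sublinear_onZ] recovers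
    equality. *)
Definition sublinear_on (R : realType) (V : lmodType R) (D : set V) (q : V -> R)
    : Prop :=
  (forall x y, D x -> D y -> q (x + y) <= q x + q y) /\
  (forall a x, 0 <= a -> D x -> q (a *: x) <= a * q x).

Definition linear_on (R : realType) (V : lmodType R) (D : set V) (q : V -> R)
    : Prop :=
  (forall x y, D x -> D y -> q (x + y) = q x + q y) /\
  (forall a x, D x -> q (a *: x) = a * q x).

Section HahnBanach.
Context {R : realType} {V : lmodType R} (D : set V) (Dlin : lin_closed D).

Lemma lin_closed0 : D 0.
Proof.
have [[x Dx] h] := Dlin.
by have := h (-1) x x Dx Dx; rewrite scaleN1r addNr.
Qed.

Lemma lin_closedD x y : D x -> D y -> D (x + y).
Proof. by move=> Dx Dy; have := Dlin.2 1 x y Dx Dy; rewrite scale1r. Qed.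

Lemma lin_closedZ a x : D x -> D (a *: x).
Proof. by move=> Dx; have := Dlin.2 a x 0 Dx lin_closed0; rewrite addr0. Qed.

Lemma lin_closedN x : D x -> D (- x).
Proof. by move=> Dx; rewrite -scaleN1r; exact: lin_closedZ. Qed.

Lemma sublinear_on0 q : sublinear_on D q -> q 0 = 0.
Proof.
move=> [qD qZ]; apply/eqP; rewrite eq_le; apply/andP; split.
  by have := qZ 0 0 (lexx _) lin_closed0; rewrite scale0r mul0r.
by have := qD _ _ lin_closed0 lin_closed0; rewrite addr0 lerDl.
Qed.

Lemma sublinear_on_opp q x : sublinear_on D q -> D x -> - q (- x) <= q x.
Proof.
move=> sq Dx; have := sq.1 _ _ Dx (lin_closedN Dx).
rewrite subrr (sublinear_on0 sq); lra.
Qed.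

Lemma sublinear_onZ q k x : sublinear_on D q -> 0 <= k -> D x ->
  q (k *: x) = k * q x.
Proof.
move=> sq; rewrite le_eqVlt => /predU1P[<- _|k0 Dx].
  by rewrite scale0r mul0r (sublinear_on0 sq).
apply/eqP; rewrite eq_le; apply/andP; split; first exact: sq.2 (ltW k0) Dx.
rewrite -ler_pdivlMl//.
have := sq.2 k^-1 (k *: x); rewrite scalerA mulVf ?gt_eqF// scale1r; apply.
  by rewrite invr_ge0 ltW.
exact: lin_closedZ.
Qed.

(** Shared by three infima: [slide], the bound of a chain in Zorn's lemma, and [envelope]. Sums and
    multiples of members need only be matched from below. *)
Lemma sublinear_on_inf (S : V -> set R) :
  (forall x, D x -> S x !=set0) -> (forall x, D x -> has_lbound (S x)) ->
  (forall x y a b, D x -> D y -> S x a -> S y b ->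
     exists2 c, S (x + y) c & c <= a + b) ->
  (forall x k a, D x -> 0 <= k -> S x a -> exists2 c, S (k *: x) c & c <= k * a) ->
  sublinear_on D (fun x => inf (S x)).
Proof.
move=> S0 Sb SD SZ; split=> [x y Dx Dy|k x k0 Dx].
  rewrite -lerBlDr; apply: lb_le_inf; first exact: S0.
  move=> a Sa; rewrite lerBlDr -lerBlDl; apply: lb_le_inf; first exact: S0.
  move=> b Sb'; rewrite lerBlDl; have [c Sc cab] := SD _ _ _ _ Dx Dy Sa Sb'.
  by apply: le_trans cab; apply: ge_inf => //; apply/Sb/lin_closedD.
have h a : S x a -> inf (S (k *: x)) <= k * a.
  move=> Sa; have [c Sc] := SZ _ _ _ Dx k0 Sa; apply: le_trans.
  by apply: ge_inf => //; apply/Sb/lin_closedZ.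
have [k0'|] := ltP 0 k; last first.
  move=> k0'; have {k0 k0'}k0 : k = 0 by apply/eqP; rewrite eq_le k0 k0'.
  by have [a /h] := S0 _ Dx; rewrite k0 !mul0r.
rewrite -ler_pdivrMl//; apply: lb_le_inf; first exact: S0.
by move=> a /h; rewrite ler_pdivrMl.
Qed.

(** The lowering of [q] that forces linearity along [v]: [t = 0] keeps it below [q], and [t = 1] at
    [- v] gives [slide_opp]. *)
Definition slide (q : V -> R) (v x : V) : R :=
  inf [set q (x + t *: v) - t * q v | t in [set t | 0 <= t]].

Lemma slide_lbound q v x : sublinear_on D q -> D v -> D x ->
  lbound [set q (x + t *: v) - t * q v | t in [set t | 0 <= t]] (- q (- x)).
Proof.
move=> sq Dv Dx _ [t /= t0 <-]; rewrite -(sublinear_onZ sq)//.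
have Dtv := lin_closedZ t Dv.
have := sq.1 (x + t *: v) (- x); rewrite addrAC subrr add0r.
move=> /(_ (lin_closedD Dx Dtv) (lin_closedN Dx)); lra.
Qed.

Lemma slide_le q v x t : sublinear_on D q -> D v -> D x -> 0 <= t ->
  slide q v x <= q (x + t *: v) - t * q v.
Proof.
move=> sq Dv Dx t0; apply: ge_inf; last by exists t.
by exists (- q (- x)); exact: slide_lbound.
Qed.

Lemma sublinear_slide q v : sublinear_on D q -> D v ->
  sublinear_on D (slide q v).
Proof.
move=> sq Dv; apply: sublinear_on_inf.
- by move=> x _; exists (q (x + 0 *: v) - 0 * q v), 0 => /=.
- by move=> x Dx; exists (- q (- x)); exact: slide_lbound.
- move=> x y _ _ Dx Dy [t /= t0 <-] [u /= u0 <-].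
  exists (q (x + y + (t + u) *: v) - (t + u) * q v).
    by exists (t + u) => //=; rewrite addr_ge0.
  have -> : x + y + (t + u) *: v = (x + t *: v) + (y + u *: v).
    by rewrite scalerDl addrACA.
  have := sq.1 (x + t *: v) (y + u *: v).
  move=> /(_ (lin_closedD Dx (lin_closedZ t Dv)) (lin_closedD Dy (lin_closedZ u Dv))).
  lra.
- move=> x k _ Dx k0 [t /= t0 <-].
  exists (q (k *: x + (k * t) *: v) - (k * t) * q v).
    by exists (k * t) => //=; rewrite mulr_ge0.
  rewrite -scalerA -scalerDr (sublinear_onZ sq)//; last first.
    exact/lin_closedD/lin_closedZ.
  by rewrite mulrBr mulrA.
Qed.

Lemma slide_le_id q v x : sublinear_on D q -> D v -> D x -> slide q v x <= q x.
Proof.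
by move=> sq Dv Dx; have := slide_le sq Dv Dx (lexx 0);
  rewrite scale0r addr0 mul0r subr0.
Qed.

Lemma slide_opp q v : sublinear_on D q -> D v -> slide q v (- v) <= - q v.
Proof.
move=> sq Dv; have := slide_le sq Dv (lin_closedN Dv) ler01.
by rewrite scale1r mul1r addNr (sublinear_on0 sq) sub0r.
Qed.

Let dominated_by (p q : V -> R) : Prop :=
  sublinear_on D q /\ forall x, D x -> q x <= p x.

(** Zorn's lemma for the reversed pointwise order. A chain is bounded by its pointwise infimum,
    which is finite because a sublinear [t] below [p] satisfies [- p (- x) <= t x]. *)
Lemma exists_min_sublinear (p : V -> R) : sublinear_on D p ->
  exists q, [/\ sublinear_on D q, (forall x, D x -> q x <= p x) &
    forall q', sublinear_on D q' -> (forall x, D x -> q' x <= q x) ->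
      forall x, D x -> q x <= q' x].
Proof.
move=> sp; pose T := {q | dominated_by p q}.
pose le (s t : T) := `[< forall x, D x -> sval t x <= sval s x >].
have dpp : dominated_by p p by split.
have [|||[q [sq qp]] qmin] := @ZL_preorder T (exist _ p dpp) le.
- by move=> t; apply/asboolP => x _.
- move=> r s t /asboolP rs /asboolP st; apply/asboolP => x Dx.
  exact: le_trans (st x Dx) (rs x Dx).
- move=> A Atot.
  have [[t0 At0]|A0] := pselect (exists t, A t); last first.
    by exists (exist _ p dpp) => s As; case: A0; exists s.
  pose S x := [set sval t x | t in A].
  have Slb x : D x -> has_lbound (S x).
    move=> Dx; exists (- p (- x)) => _ [[t [st tp]] _ <-] /=.
    apply: le_trans (sublinear_on_opp st Dx).
    by rewrite lerN2; apply/tp/lin_closedN.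
  have Sle t x : A t -> D x -> inf (S x) <= sval t x.
    by move=> At Dx; apply: ge_inf; [exact: Slb|exists t].
  have sS : sublinear_on D (fun x => inf (S x)).
    apply: sublinear_on_inf => //.
    + by move=> x _; exists (sval t0 x), t0.
    (* Of two members of a chain the smaller one serves at both [x] and [y], so its value at [x + y]
       is the witness. *)
    + move=> x y _ _ Dx Dy [s As <-] [t At <-].
      have [/asboolP st|/asboolP ts] := Atot _ _ As At.
      * exists (sval t (x + y)); first by exists t.
        by apply: (le_trans ((svalP t).1.1 _ _ Dx Dy)); rewrite lerD2r st.
      * exists (sval s (x + y)); first by exists s.
        by apply: (le_trans ((svalP s).1.1 _ _ Dx Dy)); rewrite lerD2l ts.
    + move=> x k _ Dx k0 [s As <-]; exists (sval s (k *: x)); first by exists s.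
      exact: (svalP s).1.2.
  have dS : dominated_by p (fun x => inf (S x)).
    split=> // x Dx; exact: le_trans (Sle _ _ At0 Dx) ((svalP t0).2 _ Dx).
  exists (exist _ _ dS) => s As; apply/asboolP => x Dx /=; exact: Sle.
exists q; split=> // q' sq' q'q.
have dq' : dominated_by p q'.
  by split=> // x Dx; exact: le_trans (q'q x Dx) (qp x Dx).
by have /(_ _)/asboolP := qmin (exist _ q' dq'); apply; apply/asboolP.
Qed.

(** A minimal [q] is additive: comparison with its own slide along [y] gives
    [q x <= q (x + y) - q y]. Minimizing below [slide p v] instead of [p] forces [q (- v) <= - p v],
    hence equality at [v]. *)
Lemma hahn_banach (p : V -> R) (v : V) : sublinear_on D p -> D v ->
  exists q, [/\ linear_on D q, (forall x, D x -> q x <= p x) & q v = p v].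
Proof.
move=> sp Dv.
have [q [sq qp qmin]] := exists_min_sublinear (sublinear_slide sp Dv).
have qD x y : D x -> D y -> q (x + y) = q x + q y.
  move=> Dx Dy; apply/eqP; rewrite eq_le sq.1//=.
  have := qmin _ (sublinear_slide sq Dy) (fun x Dx => slide_le_id sq Dy Dx) x Dx.
  have := slide_le sq Dy Dx ler01; rewrite scale1r mul1r; lra.
have qN x : D x -> q (- x) = - q x.
  move=> Dx; have := qD _ _ Dx (lin_closedN Dx).
  by rewrite subrr (sublinear_on0 sq); lra.
have qle x : D x -> q x <= p x.
  by move=> Dx; exact: le_trans (qp x Dx) (slide_le_id sp Dv Dx).
exists q; split=> //.
  split=> // a x Dx; have [a0|a0] := leP 0 a; first exact: sublinear_onZ.
  rewrite -(opprK a) scaleNr qN; last exact: lin_closedZ.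
  by rewrite (sublinear_onZ sq) ?mulNr// oppr_ge0 ltW.
apply/eqP; rewrite eq_le qle//=.
have := qp _ (lin_closedN Dv); have := slide_opp sp Dv; rewrite qN//; lra.
Qed.

End HahnBanach.

(** * Riesz representation on compact Hausdorff spaces *)

Definition cts (R : realType) (K : topologicalType) : set (K -> R^o) :=
  [set f : K -> R^o | continuous f].

Section ContinuousFunctions.
Context {R : realType} {K : ptopologicalType}.
Implicit Types f g : K -> R.

Lemma cts_lin_closed : lin_closed (@cts R K).
Proof.
split=> [|a f g cf cg]; first by exists (fun=> 0) => x; exact: cvg_cst.
by move=> x; apply: cvgD; [apply: cvgM; [exact: cvg_cst|exact: cf]|exact: cg].
Qed.

Lemma ctsD f g : continuous f -> continuous g -> continuous (fun x => f x + g x).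
Proof. by move=> cf cg x; exact: cvgD (cf x) (cg x). Qed.

Lemma ctsB f g : continuous f -> continuous g -> continuous (fun x => f x - g x).
Proof. by move=> cf cg x; exact: cvgB (cf x) (cg x). Qed.

Lemma ctsM f g : continuous f -> continuous g -> continuous (fun x => f x * g x).
Proof. by move=> cf cg x; exact: cvgM (cf x) (cg x). Qed.

Lemma cts_cst (c : R) : continuous (fun _ : K => c).
Proof. by move=> x; exact: cvg_cst. Qed.

Lemma cts_max f g : continuous f -> continuous g ->
  continuous (fun x => Num.max (f x) (g x)).
Proof. by move=> cf cg x; exact: (continuous_max (cf x) (cg x)). Qed.

Lemma cts_min f g : continuous f -> continuous g ->
  continuous (fun x => Num.min (f x) (g x)).
Proof. by move=> cf cg x; exact: (continuous_min (cf x) (cg x)). Qed.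

Lemma cts_measurable f : continuous f ->
  measurable_fun [set: BorelT K] (f : BorelT K -> R).
Proof.
move=> cf; apply: (measurability _ (measurable_realfun.RGenOpens.measurableE R)) => _ [_ [a [b ->] <-]].
rewrite setTI; apply: sub_sigma_algebra; apply: open_comp => // x _; exact: cf.
Qed.

Hypothesis cK : compact [set: K].

Lemma cts_bounded f : continuous f -> exists2 B : R, 0 < B & forall x, `|f x| <= B.
Proof.
move=> cf; have := @continuous_compact _ _ f setT _ cK.
move=> /(_ (continuous_subspaceT cf))/compact_bounded [B [_ hB]].
exists (`|B| + 1) => [|x]; first by rewrite ltr_wpDl.
by apply: hB => //; rewrite ltr_pwDr// ler_norm.
Qed.

Context (mu : {measure set (BorelT K) -> \bar R}) (mufin : (mu setT < +oo)%E).

Lemma cts_integrable f : continuous f -> mu.-integrable setT (EFin \o f).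
Proof.
move=> cf; apply: measurable_bounded_integrable => //; first exact: cts_measurable.
have [B B0 fB] := cts_bounded cf.
by exists B; split; [exact: num_real|move=> y By x _; exact: le_trans (fB x) (ltW By)].
Qed.

Lemma RintegralE f : continuous f ->
  (\int[mu]_x (f x)%:E = (\int[mu]_x f x)%:E)%E.
Proof.
by move=> cf; rewrite /Rintegral fineK//; exact/integrable_fin_num/cts_integrable.
Qed.

End ContinuousFunctions.

Section Riesz.
Context {R : realType} {K : ptopologicalType}.
Hypotheses (cK : compact [set: K]) (hK : hausdorff_space K).
Variable Lam : (K -> R) -> R.
Hypothesis Llin : linear_on (@cts R K) Lam.
Hypothesis Lpos : forall f : K -> R, continuous f -> (forall x, 0 <= f x) -> 0 <= Lam f.
Implicit Types (f g : K -> R) (U V : set K).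

Lemma posfunD f g : continuous f -> continuous g ->
  Lam (fun x => f x + g x) = Lam f + Lam g.
Proof. by move=> cf cg; exact: Llin.1. Qed.

Lemma posfunZ a f : continuous f -> Lam (fun x => a * f x) = a * Lam f.
Proof. by move=> cf; exact: Llin.2. Qed.

Lemma posfunB f g : continuous f -> continuous g ->
  Lam (fun x => f x - g x) = Lam f - Lam g.
Proof.
move=> cf cg; have := posfunD (ctsB cf cg) cg.
have -> : (fun x => f x - g x + g x) = f by apply/funext => x; rewrite subrK.
by move=> ->; rewrite addrK.
Qed.

Lemma posfun_cst a : Lam (fun=> a) = a * Lam (fun=> 1).
Proof.
rewrite -posfunZ; last exact: cts_cst.
by congr Lam; apply/funext => x; rewrite mulr1.
Qed.

Lemma le_posfun f g : continuous f -> continuous g -> (forall x, f x <= g x) ->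
  Lam f <= Lam g.
Proof.
move=> cf cg fg; rewrite -subr_ge0 -posfunB//; apply: Lpos; first exact: ctsB.
by move=> x; rewrite subr_ge0.
Qed.

Let total : R := Lam (fun=> 1).

Lemma total_ge0 : 0 <= total.
Proof. by apply: Lpos => //; exact: cts_cst. Qed.

(** * Content of open sets *)

Definition below U : set (K -> R) := [set f : K -> R | [/\ continuous f,
  (forall x, 0 <= f x <= 1) & forall x, ~ U x -> f x = 0]].

Definition open_content U : \bar R := ereal_sup [set (Lam f)%:E | f in below U].

Lemma below_content U f : below U f -> ((Lam f)%:E <= open_content U)%E.
Proof. by move=> bf; apply: ereal_sup_ubound; exists f. Qed.

Lemma open_content_le U c : (forall f, below U f -> ((Lam f)%:E <= c)%E) ->
  (open_content U <= c)%E.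
Proof. by move=> h; apply: ge_ereal_sup => _ [f bf <-]; exact: h. Qed.

Lemma below0 U : below U (fun=> 0).
Proof. by split=> //; [exact: cts_cst|move=> x; rewrite lexx ler01]. Qed.

Lemma open_content_ge0 U : (0 <= open_content U)%E.
Proof.
apply: le_trans (below_content (below0 U)).
by rewrite lee_fin; apply: Lpos => //; exact: cts_cst.
Qed.

Lemma open_contentS U V : U `<=` V -> (open_content U <= open_content V)%E.
Proof.
move=> UV; apply: open_content_le => f [cf f01 fU]; apply: below_content.
by split=> // x nVx; apply: fU => /UV.
Qed.

Lemma open_contentT : open_content setT = total%:E.
Proof.
apply/eqP; rewrite eq_le; apply/andP; split.
  apply: open_content_le => f [cf f01 _]; rewrite lee_fin; apply: le_posfun => //.
    exact: cts_cst.
  by move=> x; have /andP[] := f01 x.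
apply: below_content; split=> [|x|x []//]; first exact: cts_cst.
by rewrite ler01 lexx.
Qed.

Lemma open_content0 : open_content set0 = 0%E.
Proof.
apply/eqP; rewrite eq_le open_content_ge0 andbT; apply: open_content_le.
move=> f [_ _ f0]; rewrite (_ : f = fun=> 0); last by apply/funext => x; apply: f0.
by rewrite posfun_cst mul0r.
Qed.

(* Truncation replaces the condition on supports in the usual definition. *)
Definition trunc (e : R) f : K -> R := fun x => Num.max (f x - e) 0.

Lemma cts_trunc e f : continuous f -> continuous (trunc e f).
Proof.
move=> cf; apply: cts_max; last exact: cts_cst.
by apply: ctsB => //; exact: cts_cst.
Qed.

Lemma trunc_itv e f x : 0 < e -> 0 <= f x <= 1 -> 0 <= trunc e f x <= 1.
Proof.
move=> e0 /andP[f0 f1]; rewrite /trunc le_max lexx orbT/= ge_max ler01 andbT.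
by rewrite lerBlDr (le_trans f1)// lerDl ltW.
Qed.

Lemma trunc_eq0 e f x : f x <= e -> trunc e f x = 0.
Proof. by move=> fe; rewrite /trunc max_r// subr_le0. Qed.

Lemma posfun_trunc e f : continuous f -> Lam f <= Lam (trunc e f) + e * total.
Proof.
move=> cf; rewrite -posfun_cst -posfunD; [|exact: cts_trunc|exact: cts_cst].
apply: le_posfun => //; first by apply: ctsD; [exact: cts_trunc|exact: cts_cst].
by move=> x; rewrite -lerBlDr /trunc le_max lexx.
Qed.

(** Truncation at [e] loses at most [e * total], which tends to [0]. The divisor [total + 1] covers
    the case [total = 0]. *)
Lemma posfun_trunc_le f c : continuous f ->
  (forall e, 0 < e -> ((Lam (trunc e f))%:E <= c)%E) -> ((Lam f)%:E <= c)%E.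
Proof.
move=> cf h; apply/lee_addgt0Pr => e e0.
have t1 : 0 < total + 1 by rewrite ltr_wpDl// total_ge0.
have d0 : 0 < e / (total + 1) by rewrite divr_gt0.
apply: le_trans (leeD2r e%:E (h _ d0)); rewrite -EFinD lee_fin.
apply: le_trans (posfun_trunc (e / (total + 1)) cf) _; rewrite lerD2l.
by rewrite mulrAC ler_pdivrMr// ler_pM2l// lerDl.
Qed.

Lemma closed_superlevel e f : continuous f -> closed [set x | e <= f x].
Proof.
move=> cf; have := @closed_comp _ _ f [set y | e <= y].
by apply; [move=> x _; exact: cf|exact: closed_ge].
Qed.

Lemma urysohn_fun (A B : set K) : closed A -> closed B -> A `&` B = set0 ->
  exists h : K -> R, [/\ continuous h, (forall x, 0 <= h x <= 1),
    (forall x, A x -> h x = 0) & forall x, B x -> h x = 1].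
Proof.
move=> cA cB AB; have sep : uniform_separator A B.
  by move/(normal_separatorP (R := R)) : (compact_normal hK cK); apply.
exists (Urysohn A B); split.
- exact: Urysohn_continuous.
- move=> x; have := @Urysohn_range _ R A B (Urysohn A B x) (imageT _ _).
  by rewrite /= in_itv.
- by move=> x Ax; apply: (Urysohn_sub0 sep); exists x.
- by move=> x Bx; apply: (Urysohn_sub1 sep); exists x.
Qed.

(** A Urysohn function [h], zero off [U] and one on the part of [{e <= f}] outside [V], splits
    [trunc e f] into [h * trunc e f] for [U] and [(1 - h) * trunc e f] for [V]. *)
Lemma open_contentU U V : open U -> open V ->
  (open_content (U `|` V) <= open_content U + open_content V)%E.
Proof.
move=> oU oV; apply: open_content_le => f [cf f01 fUV].
apply: posfun_trunc_le => // e e0.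
pose C := [set x | e <= f x].
have [|||h [ch h01 hU hC]] := @urysohn_fun (~` U) (C `\` V).
- exact: open_closedC.
- by rewrite setDE; apply: closedI; [exact: closed_superlevel|exact: open_closedC].
- apply/seteqP; split=> x // -[nUx [/= ex nVx]].
  have f0 : f x = 0 by apply: fUV => -[].
  by move: ex; rewrite /C/= f0 leNgt e0.
have ct := @cts_trunc e f cf.
have -> : trunc e f = (fun x => h x * trunc e f x + (1 - h x) * trunc e f x).
  by apply/funext => x; rewrite -mulrDl addrC subrK mul1r.
have c1h : continuous (fun x => 1 - h x) by apply: ctsB => //; exact: cts_cst.
rewrite posfunD; [|exact: ctsM|exact: ctsM].
rewrite EFinD; apply: leeD; apply: below_content; split; try exact: ctsM.
- move=> x; have /andP[h0 h1] := h01 x.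
  have /andP[t0 t1] := trunc_itv e0 (f01 x).
  by rewrite mulr_ge0//= mulr_ile1.
- by move=> x nUx; rewrite hU// mul0r.
- move=> x; have /andP[h0 h1] := h01 x.
  have /andP[t0 t1] := trunc_itv e0 (f01 x).
  by rewrite mulr_ge0 ?subr_ge0//= mulr_ile1// ?subr_ge0// lerBlDr lerDl.
- move=> x nVx; have [ex|fe] := leP e (f x).
    by rewrite hC// subrr mul0r.
  by rewrite trunc_eq0 ?mulr0// ltW.
Qed.

(** The set [{e <= f}] is compact, so finitely many [F i] cover it and [trunc e f] is a test
    function for their union; finite subadditivity then applies. *)
Lemma open_content_bigcup (F : (set K)^nat) : (forall n, open (F n)) ->
  (open_content (\bigcup_n F n) <= \sum_(n <oo) open_content (F n))%E.
Proof.
move=> oF; apply: open_content_le => f [cf f01 fF].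
apply: posfun_trunc_le => // e e0.
pose W n := \bigcup_(i < n) F i.
have oW n : open (W n) by apply: bigcup_open => i _; exact: oF.
have leW n : (open_content (W n) <= \sum_(i < n) open_content (F i))%E.
  elim: n => [|n IH]; first by rewrite /W bigcup_mkord !big_ord0 open_content0.
  have -> : W n.+1 = W n `|` F n by rewrite /W !bigcup_mkord big_ord_recr.
  rewrite big_ord_recr/=; apply: le_trans (open_contentU _ _) _ => //.
  exact: leeD2r.
have [n CW] : exists n, [set x | e <= f x] `<=` W n.
  have cC : compact [set x | e <= f x].
    by apply: (subclosed_compact (closed_superlevel cf) cK).
  move: cC; rewrite compact_cover => /(_ nat setT F (fun i _ => oF i)).
  case=> [x /= ex|D _ CD].
    apply: contrapT => nx; move: ex; rewrite fF ?leNgt ?e0//.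
  exists (\max_(i <- finmap.enum_fset D) i).+1 => x /CD [i /= iD Fix]; exists i => //=.
  by rewrite ltnS; exact: leq_bigmax_seq.
apply: (@le_trans _ _ (open_content (W n))).
  apply: below_content; split; first exact: cts_trunc.
    by move=> x; exact: trunc_itv.
  move=> x nWx; apply: trunc_eq0; rewrite leNgt; apply/negP => ex.
  by apply: nWx; apply: CW; exact: ltW.
apply: (le_trans (leW n)); rewrite -(big_mkord xpredT (fun i => open_content (F i))).
by apply: nneseries_lim_ge => i _ _; exact: open_content_ge0.
Qed.

(** * Outer measure and Borel measurability *)

Definition outer A : \bar R :=
  ereal_inf [set open_content U | U in [set U | open U /\ A `<=` U]].

Lemma outer_le A U : open U -> A `<=` U -> (outer A <= open_content U)%E.
Proof. by move=> oU AU; apply: ereal_inf_lbound; exists U. Qed.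

Lemma le_outer (c : \bar R) A :
  (forall U, open U -> A `<=` U -> (c <= open_content U)%E) -> (c <= outer A)%E.
Proof. by move=> h; apply: le_ereal_inf_tmp => _ [U [oU AU] <-]; exact: h. Qed.

Lemma outer_open U : open U -> outer U = open_content U.
Proof.
move=> oU; apply/eqP; rewrite eq_le outer_le//=.
by apply: le_outer => V oV UV; exact: open_contentS.
Qed.

Lemma outer_ge0 A : (0 <= outer A)%E.
Proof. by apply: le_outer => U _ _; exact: open_content_ge0. Qed.

Lemma outerS A B : A `<=` B -> (outer A <= outer B)%E.
Proof.
by move=> AB; apply: le_outer => U oU BU; apply: outer_le => // x /AB /BU.
Qed.

Lemma outerT : outer setT = total%:E.
Proof. by rewrite outer_open ?open_contentT//; exact: openT. Qed.

Lemma outer_fin A : outer A \is a fin_num.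
Proof.
rewrite ge0_fin_numE ?outer_ge0//.
by apply: le_lt_trans (outerS (@subsetT _ A)) _; rewrite outerT ltry.
Qed.

Lemma outer0 : outer set0 = 0%E.
Proof. by rewrite outer_open ?open_content0//; exact: open0. Qed.

Lemma outer_adherent A (e : R) : 0 < e ->
  exists U, [/\ open U, A `<=` U & (open_content U <= outer A + e%:E)%E].
Proof.
move=> e0; have [_ [U [oU AU] <-] Ue] := lb_ereal_inf_adherent e0 (outer_fin A).
by exists U; split=> //; exact: ltW.
Qed.

Lemma outer_sigma_subadditive : sigma_subadditive outer.
Proof.
move=> A; apply/lee_addgt0Pr => e e0.
have e0' : 0 <= e by exact: ltW.
rewrite (le_trans _ (epsilon_trick _ _ _))//; last by move=> *; exact: outer_ge0.
have /choice[U hU] : forall n, exists U, [/\ open U, A n `<=` U &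
    (open_content U <= outer (A n) + (e / (2 ^ n.+1)%:R)%:E)%E].
  by move=> n; apply: outer_adherent; rewrite divr_gt0// ltr0n expn_gt0.
apply: (@le_trans _ _ (open_content (\bigcup_n U n))).
  apply: outer_le; first by apply: bigcup_open => n _; have [] := hU n.
  by apply: subset_bigcup => n _; have [] := hU n.
apply: le_trans (open_content_bigcup _) _; first by move=> n; have [] := hU n.
apply: lee_nneseries => [n _ _|n _]; first exact: open_content_ge0.
by have [] := hU n.
Qed.

HB.instance Definition _ := isOuterMeasure.Build R K outer outer0 outer_ge0
  outerS outer_sigma_subadditive.

(** Take a test function [f] for the part of [V] in [U], then a test function [g] for [V] minus [C],
    where [C] is [{e <= f}]. Since [g] vanishes on [C] and [trunc e f] vanishes off [C], their sum
    is still at most [1] and is a test function for [V]. *)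
Lemma open_caratheodory U : open U -> outer.-caratheodory U.
Proof.
move=> oU; apply: le_caratheodory_measurable => X.
apply: le_outer => V oV XV.
rewrite -leeBrDr ?outer_fin//.
apply: (@le_trans _ _ (open_content (V `&` U))).
  by apply: outer_le; [exact: openI|exact: setSI].
apply: open_content_le => f [cf f01 fVU]; apply: posfun_trunc_le => // e e0.
rewrite leeBrDr ?outer_fin// addeC -leeBrDr//.
pose C := [set x | e <= f x].
have oVC : open (V `\` C).
  by rewrite setDE; apply: openI => //; apply: closed_openC; exact: closed_superlevel.
apply: (@le_trans _ _ (open_content (V `\` C))).
  apply: outer_le => // x [/XV Vx nUx]; split=> //.
  rewrite /C/= fVU ?leNgt ?e0//; first by case.
apply: open_content_le => g [cg g01 gVC].
rewrite leeBrDr// -EFinD -posfunD//; last exact: cts_trunc.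
apply: below_content; split.
- by apply: ctsD => //; exact: cts_trunc.
- move=> x; have /andP[t0 t1] := trunc_itv e0 (f01 x).
  have /andP[g0 g1] := g01 x; rewrite addr_ge0//=.
  have [ex|fe] := leP e (f x).
    by rewrite gVC ?add0r// => -[_]; exact.
  by rewrite trunc_eq0 ?addr0// ltW.
- move=> x nVx; rewrite gVC ?add0r; last by case.
  by apply: trunc_eq0; rewrite fVU ?ltW// => -[].
Qed.

Lemma borel_caratheodory :
  (@measurable _ (BorelT K)) `<=` outer.-cara.-measurable.
Proof.
apply: smallest_sub; last by move=> U oU; exact: open_caratheodory.
split; [exact: measurable0|by move=> X mX; rewrite setTD; exact: measurableC|].
by move=> u_ mu_; exact: bigcupT_measurable.
Qed.

Definition riesz_measure : set (BorelT K) -> \bar R := outer.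

Let riesz_measure0 : riesz_measure set0 = 0%E.
Proof. exact: outer0. Qed.

Let riesz_measure_ge0 A : (0 <= riesz_measure A)%E.
Proof. exact: outer_ge0. Qed.

Let riesz_measure_semi_sigma_additive : semi_sigma_additive riesz_measure.
Proof.
move=> F mF tF mUF; rewrite /riesz_measure.
apply: caratheodory_measure_sigma_additive => //; last exact: borel_caratheodory.
by move=> i; exact: (borel_caratheodory (mF i)).
Qed.

HB.instance Definition _ := isMeasure.Build _ _ _ riesz_measure
  riesz_measure0 riesz_measure_ge0 riesz_measure_semi_sigma_additive.

Lemma riesz_measureT_lty : (riesz_measure setT < +oo)%E.
Proof. by rewrite /riesz_measure outerT ltry. Qed.

Lemma radon_riesz_measure : radon riesz_measure.
Proof.
split=> [|A mA]; first exact: riesz_measureT_lty.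
have hfin B : riesz_measure B \is a fin_num by exact: outer_fin.
apply/eqP; rewrite eq_le; apply/andP; split; last first.
  by apply: ge_ereal_sup => _ [C [_ CA] <-]; exact: outerS.
apply/lee_addgt0Pr => e e0.
have [U [oU AU Ue]] := outer_adherent (~` A) e0.
rewrite -(outer_open oU) in Ue.
have mU : measurable (U : set (BorelT K)) by exact: sub_sigma_algebra.
have CA : ~` U `<=` A by rewrite -[A]setCK; exact: subsetC.
apply: (@le_trans _ _ (riesz_measure (~` U) + e%:E)%E); last first.
  apply: leeD2r; apply: ereal_sup_ubound; exists (~` U) => //; split=> //.
  by apply: (subclosed_compact _ cK) => //; exact: open_closedC.
have additivity B : measurable B ->
    (riesz_measure B + riesz_measure (~` B) = riesz_measure setT)%E.
  move=> mB; rewrite -measureU//; [by rewrite setUCr|exact: measurableC|].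
  by rewrite setICr.
have := additivity _ mA; rewrite -(additivity _ mU).
move: Ue; rewrite -[outer U]/(riesz_measure U) -[outer (~` A)]/(riesz_measure (~` A)).
rewrite -(fineK (hfin U)) -(fineK (hfin (~` U))) -(fineK (hfin A)).
rewrite -(fineK (hfin (~` A))) -!EFinD !lee_fin => + [].
lra.
Qed.

(** * Comparison of the integral with the functional *)

Let I f : R := \int[riesz_measure]_x f x.

(** Cut [f] into [n] horizontal slices of height [c]. The bottom slice [min f c] has integral at
    most [c] times the measure of [{0 < f}], while [Lam] of it is at least [c] times the measure of
    [{c < f}]. These errors telescope through the induction, leaving only the first one. *)
Lemma Rintegral_riesz_le_step n (c : R) f : 0 < c -> continuous f ->
  (forall x, 0 <= f x <= n%:R * c) ->
  I f <= Lam f + c * fine (riesz_measure [set x | 0 < f x]).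
Proof.
move=> c0; elim: n f => [|n IH] f cf f0n.
  have -> : f = fun=> 0.
    by apply/funext => x; apply/eqP; rewrite eq_le -[X in _ <= X](mul0r c) andbC.
  rewrite posfun_cst mul0r add0r /I Rintegral_cst// mul0r.
  by apply: mulr_ge0; [exact: ltW|apply: fine_ge0].
have intf g : continuous g -> riesz_measure.-integrable setT (EFin \o g).
  exact: (cts_integrable cK riesz_measureT_lty).
have ct := @cts_trunc c f cf.
have cc : continuous (fun x => Num.min (f x) c) by apply: cts_min => //; exact: cts_cst.
have fE : f = fun x => trunc c f x + Num.min (f x) c.
  apply/funext => x; rewrite /trunc; have [fc|fc] := leP (f x) c.
    by rewrite max_r ?add0r// subr_le0.
  by rewrite max_l ?subrK// subr_ge0 ltW.
have oU : open [set x | 0 < f x].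
  have := @open_comp _ _ f [set y | 0 < y].
  by apply; [move=> x _; exact: cf|exact: open_gt].
have oUc : open [set x | 0 < trunc c f x].
  have := @open_comp _ _ (trunc c f) [set y | 0 < y].
  by apply; [move=> x _; exact: ct|exact: open_gt].
have mU : measurable ([set x | 0 < f x] : set (BorelT K)) by exact: sub_sigma_algebra.
have IfE : I f = I (trunc c f) + I (fun x => Num.min (f x) c).
  by rewrite {1}fE /I RintegralD//; exact: intf.
have LfE : Lam f = Lam (trunc c f) + Lam (fun x => Num.min (f x) c).
  by rewrite {1}fE posfunD.
have h1 : I (trunc c f) <= Lam (trunc c f) + c * fine (riesz_measure [set x | 0 < trunc c f x]).
  apply: IH => // x; rewrite /trunc le_max lexx orbT/= ge_max.
  have /andP[f0 fn] := f0n x.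
  apply/andP; split; last by apply: mulr_ge0; [exact: ler0n|exact: ltW].
  by rewrite lerBlDr (le_trans fn)// -natr1 mulrDl mul1r.
have i1 : riesz_measure.-integrable setT (EFin \o (\1_[set x | 0 < f x] : BorelT K -> R)).
  apply: measurable_bounded_integrable => //; first exact: riesz_measureT_lty.
  exists 1; split=> // y y1 x _; rewrite /= indicE.
  by case: (_ \in _); rewrite ?normr1 ?normr0 ltW// (lt_trans ltr01).
have h2 : I (fun x => Num.min (f x) c) <= c * fine (riesz_measure [set x | 0 < f x]).
  have -> : c * fine (riesz_measure [set x | 0 < f x]) =
      \int[riesz_measure]_x (c * \1_[set x | 0 < f x] x).
    rewrite RintegralZl//.
    by rewrite /Rintegral integral_indic// setIT.
  apply: le_Rintegral => //; first exact: intf.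
    exact: (integrableZl measurableT c i1).
  move=> x _; rewrite indicE; have [f0|f0] := ltP 0 (f x).
    by rewrite mem_set//= mulr1 ge_min lexx orbT.
  by rewrite memNset/= ?mulr0 ?ge_min ?f0// => /(le_lt_trans f0); rewrite ltxx.
have h3 : c * fine (riesz_measure [set x | 0 < trunc c f x]) <=
    Lam (fun x => Num.min (f x) c).
  rewrite -ler_pdivlMl// -lee_fin fineK; last exact: outer_fin.
  rewrite /riesz_measure outer_open//; apply: open_content_le => g [cg g01 g0].
  rewrite lee_fin -posfunZ//; apply: le_posfun => //; first by apply: ctsM => //; exact: cts_cst.
  move=> x; rewrite ler_pdivlMl//; have /andP[gx0 gx1] := g01 x.
  have /andP[f0 _] := f0n x.
  have [fc|fc] := leP (f x) c.
    by rewrite g0 ?mulr0// /trunc/= max_r ?ltxx// subr_le0.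
  by rewrite -[leRHS]mulr1 ler_pM2l.
lra.
Qed.

Lemma Rintegral_riesz_le0 f : continuous f -> (forall x, 0 <= f x) -> I f <= Lam f.
Proof.
move=> cf f0; have [B B0 fB] := cts_bounded cK cf.
apply/ler_addgt0Pr => e e0.
have t1 : 0 < total + 1 by rewrite ltr_wpDl// total_ge0.
pose c := e / (total + 1); have c0 : 0 < c by rewrite divr_gt0.
have [n nB] : exists n : nat, B <= n%:R * c.
  exists (Num.truncn (B / c)).+1; rewrite -ler_pdivrMr//; apply: ltW.
  by apply: Num.Theory.truncnS_gt.
have := @Rintegral_riesz_le_step n c f c0 cf.
move=> /(_ _)/le_trans; apply.
  by move=> x; rewrite f0/= (le_trans _ nB)// (le_trans _ (fB x))// ler_norm.
rewrite lerD2l (@le_trans _ _ (c * total))//.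
  rewrite ler_pM2l// -lee_fin fineK; last exact: outer_fin.
  by rewrite -outerT; exact: outerS.
by rewrite /c mulrAC ler_pdivrMr// ler_pM2l// lerDl.
Qed.

(** Adding a bound [B] makes [f] nonnegative and raises both sides by [B * total], the total mass
    being [total]. *)
Lemma Rintegral_riesz_le f : continuous f -> I f <= Lam f.
Proof.
move=> cf; have [B B0 fB] := cts_bounded cK cf.
have cfB : continuous (fun x => f x + B) by apply: ctsD => //; exact: cts_cst.
have := Rintegral_riesz_le0 cfB.
rewrite posfunD//; last exact: cts_cst.
have intf g : continuous g -> riesz_measure.-integrable setT (EFin \o g).
  exact: (cts_integrable cK riesz_measureT_lty).
rewrite /I RintegralD//; [|exact: intf|by apply: intf; exact: cts_cst].
have -> : \int[riesz_measure]_x B = B * total.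
  rewrite Rintegral_cst//; congr (_ * _).
  by rewrite -[RHS]/(fine total%:E) -outerT.
rewrite [Lam (fun=> B)]posfun_cst lerD2r.
by apply => x; rewrite -lerBlDr sub0r; have := fB x; rewrite ler_norml => /andP[].
Qed.

Lemma riesz_representation : exists nu : {measure set (BorelT K) -> \bar R},
  radon nu /\ forall f, continuous f -> \int[nu]_x f x = Lam f.
Proof.
exists riesz_measure; split=> [|f cf]; first exact: radon_riesz_measure.
apply/eqP; rewrite eq_le Rintegral_riesz_le//=.
(* The inequality already proved, applied to [- f], is the reverse inequality for [f]. *)
have cNf : continuous (fun x => -1 * f x) by apply: ctsM => //; exact: cts_cst.
have := Rintegral_riesz_le cNf; rewrite posfunZ// /I RintegralZl//.
  by rewrite !mulN1r lerN2.
exact: (cts_integrable cK riesz_measureT_lty).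
Qed.

End Riesz.

(** * Geometry of the off-diagonal pairs *)

Section ConcaveGauge.
Context {R : realType}.
Implicit Types s t e : R.

(** The cost [d * g0] of the strict function [g0], seen as a function of the distance; see
    [cost_strict]. *)
Definition gauge t : R := t / (1 + t).

Lemma gaugeE t : 0 <= t -> gauge t = 1 - (1 + t)^-1.
Proof. by move=> t0; rewrite /gauge; field; rewrite gt_eqF// ltr_wpDr. Qed.

Lemma gauge_le s t e : 0 <= s -> 0 <= t -> 0 <= e -> s <= t + e ->
  gauge s <= gauge t + e.
Proof.
move=> s0 t0 e0 ste; rewrite !gaugeE//.
have s1 : 0 < 1 + s by rewrite ltr_wpDr.
have t1 : 0 < 1 + t by rewrite ltr_wpDr.
rewrite -subr_ge0.
have -> : 1 - (1 + t)^-1 + e - (1 - (1 + s)^-1) =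
    (t - s + e * ((1 + s) * (1 + t))) / ((1 + s) * (1 + t)).
  by field; rewrite !gt_eqF.
apply: divr_ge0; last by rewrite mulr_ge0 ?ltW.
have : 0 <= e * (s + t + s * t) by rewrite mulr_ge0 ?addr_ge0 ?mulr_ge0.
lra.
Qed.

(* [1 - gauge] is [t |-> (1 + t)^-1], which is supermultiplicative. *)
Lemma gaugeD_le s t : 0 <= s -> 0 <= t ->
  gauge (s + t) <= gauge s + gauge t - gauge s * gauge t.
Proof.
move=> s0 t0; rewrite !gaugeE ?addr_ge0//.
have s1 : 0 < 1 + s by rewrite ltr_wpDr.
have t1 : 0 < 1 + t by rewrite ltr_wpDr.
have st1 : 0 < 1 + (s + t) by rewrite ltr_wpDr ?addr_ge0.
have : (1 + s)^-1 * (1 + t)^-1 <= (1 + (s + t))^-1.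
  rewrite -invfM lef_pV2 ?posrE ?mulr_gt0//.
  by have := mulr_ge0 s0 t0; lra.
lra.
Qed.

Lemma gauge_subadd s t : 0 <= s -> 0 <= t -> gauge (s + t) <= gauge s + gauge t.
Proof.
move=> s0 t0; apply: le_trans (gaugeD_le s0 t0) _.
by rewrite gerBl mulr_ge0// /gauge divr_ge0// addr_ge0.
Qed.

Lemma gauge_mono s t : 0 <= s -> s <= t -> gauge s <= gauge t.
Proof.
move=> s0 st; have t0 := le_trans s0 st.
by rewrite -[leRHS]addr0; apply: gauge_le; rewrite ?addr0.
Qed.

End ConcaveGauge.

Lemma dense_range (T : Type) (X : topologicalType) (f : T -> X) (z : X) (U : set X) :
  closure (range f) = [set: X] -> nbhs z U -> exists w, U (f w).
Proof.
move=> fX zU; have : closure (range f) z by rewrite fX.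
by move=> /(_ _ zU) [_ [[w _ <-] Uw]]; exists w.
Qed.

(** * Costs of pairs, and approximation of points of [K] by pairs *)

Section OffDiagonal.
Context {R : realType} {M : Type} (d : M -> M -> R) (hmetric : is_metric d).
Context {K : ptopologicalType} (iota : Mt M -> K) (hK : is_stone_cech d iota).

Let dxx x : d x x = 0. Proof. exact/hmetric.1. Qed.
Let dC x y : d x y = d y x. Proof. exact: hmetric.2.1. Qed.
Let dtri x y z : d x z <= d x y + d y z. Proof. exact: hmetric.2.2. Qed.

Lemma metric_ge0 x y : 0 <= d x y.
Proof. by have := dtri x y x; rewrite dxx (dC y x) -mulr2n pmulrn_lge0. Qed.

Lemma mkMt_val (w : Mt M) (h : (sval w).1 <> (sval w).2) : mkMt h = w.
Proof. by case: w h => -[x y] /= xy h; congr exist; exact: Prop_irrelevance. Qed.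

Lemma in_G_cst c : 0 <= c -> in_G d iota (fun=> c).
Proof.
move=> c0; split=> [|x u y _ _ _]; first exact: cts_cst.
by rewrite -mulrDl ler_wpM2r.
Qed.

Lemma in_GD g h : in_G d iota g -> in_G d iota h -> in_G d iota (fun x => g x + h x).
Proof.
move=> [cg Gg] [ch Gh]; split=> [|x u y xu uy xy]; first exact: ctsD.
have := Gg x u y xu uy xy; have := Gh x u y xu uy xy; lra.
Qed.

Lemma in_GZ a g : 0 <= a -> in_G d iota g -> in_G d iota (fun x => a * g x).
Proof.
move=> a0 [cg Gg]; split=> [|x u y xu uy xy].
  by apply: ctsM => //; exact: cts_cst.
by have := ler_wpM2l a0 (Gg x u y xu uy xy); lra.
Qed.

(* The weighted function [d * g], extended by [0] to the diagonal. *)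
Definition cost (g : K -> R) (x y : M) : R :=
  if pselect (x <> y) is left h then d x y * g (iota (mkMt h)) else 0.

Lemma costxx g x : cost g x x = 0.
Proof. by rewrite /cost; case: pselect. Qed.

Lemma costE g x y (h : x <> y) : cost g x y = d x y * g (iota (mkMt h)).
Proof.
by rewrite /cost; case: pselect => // h'; rewrite (Prop_irrelevance h' h).
Qed.

Lemma cost_Mt g (w : Mt M) :
  cost g (sval w).1 (sval w).2 = d (sval w).1 (sval w).2 * g (iota w).
Proof. by rewrite (costE g (svalP w)) mkMt_val. Qed.

Hypothesis h3 : exists a b c : M, [/\ a <> b, b <> c & a <> c].

(** Used for the degenerate triangle from [x] to [u] and back, about which [in_G] says nothing
    directly. *)
Lemma third_point (x y : M) : exists z, z <> x /\ z <> y.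
Proof.
have [a [b [c [ab bc ac]]]] := h3.
have [ax|ax] := pselect (a = x); have [ay|ay] := pselect (a = y); try by exists a.
- have [bx|bx] := pselect (b = x); first by case: ab; rewrite ax bx.
  by exists b; rewrite -ay; split=> // /esym.
- have [bY|bY] := pselect (b = y).
    by exists c; rewrite -ax -bY; split=> /esym.
  by exists b; rewrite -ax; split=> // /esym.
- have [bx|bx] := pselect (b = x).
    by exists c; rewrite -ay -bx; split=> /esym.
  by exists b; rewrite -ay; split=> // /esym.
Qed.

Lemma cost_triangle g x u y : in_G d iota g ->
  cost g x y <= cost g x u + cost g u y.
Proof.
move=> [_ Gg].
have dist (a b c : M) : a <> b -> b <> c -> a <> c ->
    cost g a c <= cost g a b + cost g b c.
  by move=> ab bc ac; rewrite (costE g ab) (costE g bc) (costE g ac).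
have [<-|xu] := pselect (x = u); first by rewrite costxx add0r.
have [<-|uy] := pselect (u = y); first by rewrite costxx addr0.
have [<-|xy] := pselect (x = y); last exact: dist.
(* [x -> v <= x -> u -> v <= x -> u -> x -> v] for a third point [v] *)
have [v [vx vu]] := third_point x u.
have h1 := dist x u v xu (nesym vu) (nesym vx).
have h2 := dist u x v (nesym xu) (nesym vx) (nesym vu).
rewrite costxx; lra.
Qed.

Lemma exists_strict : exists g0 : K -> R, continuous g0 /\
  forall w : Mt M, g0 (iota w) = (1 + d (sval w).1 (sval w).2)^-1.
Proof.
have [_ _ _ _ ext] := hK.
have pos (w : Mt M) : 0 < 1 + d (sval w).1 (sval w).2.
  by rewrite ltr_wpDr// metric_ge0.
have [|| g0 cg0 g0E] := ext (fun w => (1 + d (sval w).1 (sval w).2)^-1);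
  last by exists g0.
- move=> z e e0; exists e => // z' hz.
  set a := d (sval z).1 (sval z).2; set b := d (sval z').1 (sval z').2.
  have a0 : 0 <= a by exact: metric_ge0.
  have b0 : 0 <= b by exact: metric_ge0.
  have ab : `|a - b| < e.
    apply: le_lt_trans hz; rewrite ler_norml /a /b.
    have t1 := dtri (sval z).1 (sval z').1 (sval z).2.
    have t2 := dtri (sval z').1 (sval z').2 (sval z).2.
    have t3 := dtri (sval z').1 (sval z).1 (sval z').2.
    have t4 := dtri (sval z).1 (sval z).2 (sval z').2.
    rewrite (dC (sval z').1 (sval z).1) in t3.
    rewrite (dC (sval z').2 (sval z).2) in t2.
    by apply/andP; split; lra.
  (* Since [gauge t = 1 - (1 + t)^-1], the Lipschitz bound [gauge_le] in both directions controls
     the difference of the two inverses by [|a - b|]. *)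
  apply: le_lt_trans ab; rewrite ler_norml.
  have h1 : a <= b + `|a - b| by have := ler_norm (a - b); lra.
  have h2 : b <= a + `|a - b| by rewrite distrC; have := ler_norm (b - a); lra.
  have := gauge_le a0 b0 (normr_ge0 _) h1; have := gauge_le b0 a0 (normr_ge0 _) h2.
  by rewrite !gaugeE// => ? ?; apply/andP; split; lra.
- exists 1 => w; rewrite ger0_norm; last by rewrite invr_ge0 ltW.
  by rewrite invf_le1// lerDl metric_ge0.
Qed.

Section Strict.
Variable g0 : K -> R.
Hypothesis cg0 : continuous g0.
Hypothesis g0E : forall w : Mt M, g0 (iota w) = (1 + d (sval w).1 (sval w).2)^-1.

Lemma cost_strict x y : cost g0 x y = gauge (d x y).
Proof.
have [<-|xy] := pselect (x = y); first by rewrite costxx dxx /gauge mul0r.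
by rewrite (costE _ xy) g0E.
Qed.

Lemma in_G_strict : in_G d iota g0.
Proof.
split=> // x u y xu uy xy; rewrite -!costE !cost_strict.
apply: le_trans (gauge_subadd (metric_ge0 _ _) (metric_ge0 _ _)).
exact: gauge_mono (metric_ge0 _ _) (dtri _ _ _).
Qed.

Context {L : ptopologicalType} (j : M -> L) (hL : is_samuel d j).
Context (p1 p2 : K -> L) (hp1 : continuous p1) (hp2 : continuous p2).
Hypothesis hp1e : forall z : Mt M, p1 (iota z) = j (sval z).1.
Hypothesis hp2e : forall z : Mt M, p2 (iota z) = j (sval z).2.

Let iota_dense (z : K) (U : set K) : nbhs z U -> exists w, U (iota w).
Proof. by have [_ _ iK _ _] := hK; exact: dense_range. Qed.

Let nbhs_lt (f : K -> R) (z : K) c : continuous f -> f z < c -> nbhs z [set x | f x < c].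
Proof. by move=> cf fz; exact: (cvgr_lt _ (cf z) _ fz). Qed.

Let nbhs_gt (f : K -> R) (z : K) c : continuous f -> c < f z -> nbhs z [set x | c < f x].
Proof. by move=> cf fz; exact: (cvgr_gt _ (cf z) _ fz). Qed.

(** Finite [d0] at both ends bounds the distances to [x0], hence the length, of all pairs near [z];
    so [g0] stays away from [0] there. *)
Lemma strict_gt0 (d0 : L -> \bar R) x0 (z : K) : continuous d0 ->
  (forall x, d0 (j x) = (d x x0)%:E) ->
  (d0 (p1 z) < +oo)%E -> (d0 (p2 z) < +oo)%E -> 0 < g0 z.
Proof.
move=> cd0 d0E.
have bound (p : K -> L) : continuous p -> (d0 (p z) < +oo)%E ->
    exists2 B : R, 0 < B & nbhs z [set x | (d0 (p x) < B%:E)%E].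
  move=> cp fin; have [B B0 zB] : exists2 B : R, 0 < B & (d0 (p z) < B%:E)%E.
    move: fin; case: (d0 (p z)) => [r _|//|_]; last by exists 1; rewrite ?ltNyr.
    exists (`|r| + 1); first by rewrite ltr_wpDl.
    by rewrite lte_fin ltr_pwDr// ler_norm.
  exists B => //; apply: open_nbhs_nbhs; split; last exact: zB.
  have := @open_comp _ _ (d0 \o p) [set y | (y < B%:E)%E].
  apply; last exact: open_ereal_lt_ereal.
  by move=> x _; apply: continuous_comp; [exact: cp|exact: cd0].
move=> /(bound _ hp1) [B1 B10 n1] /(bound _ hp2) [B2 B20 n2].
have B12 : 0 < 1 + (B1 + B2) by rewrite addr_gt0// addr_gt0.
apply: (@lt_le_trans _ _ (1 + (B1 + B2))^-1); first by rewrite invr_gt0.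
rewrite leNgt; apply/negP => /(nbhs_lt cg0) n3.
have [w [/= []]] := iota_dense (filterI (filterI n1 n2) n3).
rewrite hp1e hp2e !d0E !lte_fin g0E => h1 h2.
have dw : 0 < 1 + d (sval w).1 (sval w).2 by rewrite ltr_wpDr// metric_ge0.
rewrite ltf_pV2 ?posrE// => h4.
have := dtri (sval w).1 x0 (sval w).2; rewrite (dC x0); lra.
Qed.

(** If [g0 z] were at least [1], pairs near [z] would be arbitrarily short, and a function on [L]
    separating [p1 z] from [p2 z], uniformly continuous on [M], could not tell their ends apart. *)
Lemma strict_lt1 (z : K) : p1 z <> p2 z -> g0 z < 1.
Proof.
move=> p12; have [cL hausL _ uL _] := hL.
rewrite ltNge; apply/negP => g0z.
have cl (x : L) : closed [set x].
  exact/accessible_closed_set1/hausdorff_accessible.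
have [|F [cF F01 F0 F1]] := urysohn_fun (R := R) cL hausL (cl (p1 z)) (cl (p2 z)).
  by apply/seteqP; split=> // x [/= -> ].
have [//|del del0 Fdel] := uL _ cF 2^-1.
have n1 : nbhs z [set x | F (p1 x) < 4^-1].
  apply: (nbhs_lt (f := F \o p1)).
    by move=> x; apply: continuous_comp; [exact: hp1|exact: cF].
  by rewrite /= F0.
have n2 : nbhs z [set x | 3 / 4 < F (p2 x)].
  apply: (nbhs_gt (f := F \o p2)).
    by move=> x; apply: continuous_comp; [exact: hp2|exact: cF].
  by rewrite /= F1//; lra.
have n3 : nbhs z [set x | (1 + del)^-1 < g0 x].
  apply: nbhs_gt => //; apply: lt_le_trans g0z.
  by rewrite invf_lt1 ?ltrDl// addr_gt0.
have [w [/= []]] := iota_dense (filterI (filterI n1 n2) n3).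
rewrite hp1e hp2e g0E => h1 h2.
have dw : 0 < 1 + d (sval w).1 (sval w).2 by rewrite ltr_wpDr// metric_ge0.
have del1 : 0 < 1 + del by rewrite addr_gt0.
rewrite ltf_pV2 ?posrE// => h3'.
have /Fdel /= : d (sval w).1 (sval w).2 < del by lra.
rewrite ltr_norml => /andP[]; lra.
Qed.

(** Otherwise the distance to the second ends of the pairs in [U1], capped at [e] to be bounded, is
    uniformly continuous and extends to [L]. It would vanish at [p2 z1] and equal [e] at [p1 z2],
    which are the same point. *)
Lemma close_pairs (z1 z2 : K) (U1 U2 : set K) (e : R) : 0 < e -> p2 z1 = p1 z2 ->
  nbhs z1 U1 -> nbhs z2 U2 ->
  exists w1 w2, [/\ U1 (iota w1), U2 (iota w2) & d (sval w1).2 (sval w2).1 < e].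
Proof.
move=> e0 p21 zU1 zU2; apply: contrapT => far.
have {}far w1 w2 : U1 (iota w1) -> U2 (iota w2) -> e <= d (sval w1).2 (sval w2).1.
  by move=> h1 h2; rewrite leNgt; apply/negP => h; apply: far; exists w1, w2.
have [_ _ _ _ extL] := hL.
pose S v := [set Num.min (d v (sval w).2) e | w in [set w | U1 (iota w)]].
have [w0 Uw0] := iota_dense zU1.
have S0 v : S v !=set0 by exists (Num.min (d v (sval w0).2) e), w0.
have Slb v : lbound (S v) 0.
  by move=> _ [w _ <-]; rewrite le_min metric_ge0 ltW.
have Shl v : has_lbound (S v) by exists 0.
pose f v := inf (S v).
have f_ge0 v : 0 <= f v by apply: lb_le_inf.
have f_le v : f v <= e.
  apply: (@le_trans _ _ (Num.min (d v (sval w0).2) e)); last by rewrite ge_min lexx orbT.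
  by apply: ge_inf => //; exists w0.
have fLip x y : f x <= f y + d x y.
  rewrite -lerBlDr; apply: lb_le_inf => // _ [w Uw <-]; rewrite lerBlDr.
  apply: (@le_trans _ _ (Num.min (d x (sval w).2) e)).
    by apply: ge_inf => //; exists w.
  have t := dtri x y (sval w).2; have p := metric_ge0 x y.
  by rewrite /Num.min; case: ifP; case: ifP; lra.
have [||F cF FE] := extL f.
- move=> eps eps0; exists eps => // x y xy; apply: le_lt_trans xy.
  by rewrite ler_norml; have := fLip x y; have := fLip y x; rewrite (dC y x) => ? ?;
    apply/andP; split; lra.
- by exists e => v; rewrite ger0_norm.
have cF1 : continuous (F \o p1).
  by move=> x; apply: continuous_comp; [exact: hp1|exact: cF].
have cF2 : continuous (F \o p2).
  by move=> x; apply: continuous_comp; [exact: hp2|exact: cF].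
have [Fe|Fe] := ltP (F (p1 z2)) e.
  have [w [/= + Uw]] := iota_dense (filterI (nbhs_lt cF1 Fe) zU2).
  rewrite hp1e FE ltNge => /negP; apply.
  apply: lb_le_inf => // _ [w' Uw' <-]; rewrite le_min lexx andbT dC.
  exact: far.
have Fz1 : 0 < (F \o p2) z1 by rewrite /= p21 (lt_le_trans e0).
have [w [/= + Uw]] := iota_dense (filterI (nbhs_gt cF2 Fz1) zU1).
rewrite hp2e FE ltNge => /negP; apply.
apply: ge_inf => //; exists w => //.
by rewrite dxx min_l// ltW.
Qed.

Lemma no_transfer_point z1 z2 :
  0 < g0 z1 < 1 -> 0 < g0 z2 < 1 -> p2 z1 = p1 z2 ->
  ~ (forall e : R, 0 < e -> exists g, [/\ in_G d iota g, (forall z, 0 <= g z + g0 z),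
       g z1 + g0 z1 < e & g z2 + g0 z2 < e]).
Proof.
move=> /andP[c10 c11] /andP[c20 c21] p21 approx.
set c1 := g0 z1 in c10 c11 *; set c2 := g0 z2 in c20 c21 *.
(* Error budget: near [z1] and [z2] the two gauges exceed [(1 - c1) / 2] and [(1 - c2) / 2], so the
   gain in [gaugeD_le] exceeds [k]. [D] bounds the sum of the two lengths. The approximation error
   [k / (4 * D)] and the gap [del] cost at most [k / 4] each. *)
pose k : R := (1 - c1) * (1 - c2) / 4.
have k0 : 0 < k by rewrite divr_gt0// mulr_gt0// subr_gt0.
pose D := 2 / c1 + 2 / c2.
have D0 : 0 < D by rewrite addr_gt0// divr_gt0.
have [|g [Gg gg0 gz1 gz2]] := approx (k / (4 * D)).
  by rewrite divr_gt0// mulr_gt0.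
have [cK _ _ _ _] := hK.
have [C C0 gC] := cts_bounded cK Gg.1.
have C1 : 0 < C + 1 by rewrite addr_gt0.
pose del : R := k / (4 * (C + 1)).
have del0 : 0 < del by rewrite divr_gt0// mulr_gt0.
have csum : continuous (fun x => g x + g0 x) by apply: ctsD => //; exact: Gg.1.
have near (z : K) c : g0 z = c -> 0 < c -> c < 1 -> g z + g0 z < k / (4 * D) ->
    nbhs z ([set x | g x + g0 x < k / (4 * D)] `&` [set x | c / 2 < g0 x]
            `&` [set x | g0 x < (1 + c) / 2]).
  move=> zc c0 c1' gz; apply: filterI; first apply: filterI.
  - exact: nbhs_lt.
  - by apply: nbhs_gt => //; rewrite zc; lra.
  - by apply: nbhs_lt => //; rewrite zc; lra.
have [w1 [w2 [[[/= a1 b1] e1] [[/= a2 b2] e2] close]]] :=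
  close_pairs del0 p21 (near z1 c1 erefl c10 c11 gz1) (near z2 c2 erefl c20 c21 gz2).
have bounds (w : Mt M) c : 0 < c -> c / 2 < g0 (iota w) -> g0 (iota w) < (1 + c) / 2 ->
    d (sval w).1 (sval w).2 <= 2 / c /\
    (1 - c) / 2 < gauge (d (sval w).1 (sval w).2).
  move=> c0; rewrite gaugeE ?metric_ge0// g0E => h1 h2; split; last lra.
  have : (1 + d (sval w).1 (sval w).2) < (c / 2)^-1.
    by rewrite -ltf_pV2 ?invrK// posrE ?invr_gt0 ?divr_gt0// ltr_wpDr// metric_ge0.
  by rewrite invf_div; lra.
have [D1 f1] := bounds w1 c1 c10 b1 e1.
have [D2 f2] := bounds w2 c2 c20 b2 e2.
have cw (w : Mt M) : g (iota w) + g0 (iota w) < k / (4 * D) ->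
    cost g (sval w).1 (sval w).2 <= k / (4 * D) * d (sval w).1 (sval w).2
      - gauge (d (sval w).1 (sval w).2).
  move=> h; rewrite -cost_strict !cost_Mt.
  have := ler_wpM2l (metric_ge0 (sval w).1 (sval w).2) (ltW h); lra.
move: (cw _ a1) (cw _ a2) D1 D2 f1 f2 close => {cw bounds near a1 a2 b1 b2 e1 e2}.
move: (sval w1).1 (sval w1).2 (sval w2).1 (sval w2).2 => x u u' y.
move=> cxu cuy D1 D2 f1 f2 close.
have cuu : cost g u u' <= C * del.
  apply: (@le_trans _ _ (C * d u u')); last by rewrite ler_pM2l// ltW.
  have [<-|uu'] := pselect (u = u'); first by rewrite costxx dxx mulr0.
  rewrite (costE _ uu') mulrC ler_wpM2r ?metric_ge0//.
  exact: le_trans (ler_norm _) (gC _).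
have cxy : - gauge (d x y) <= cost g x y.
  rewrite -cost_strict; have [<-|xy] := pselect (x = y); first by rewrite !costxx oppr0.
  rewrite !(costE _ xy) -mulrN ler_wpM2l ?metric_ge0// -subr_ge0 opprK.
  exact: gg0.
have gxy : gauge (d x y) <= gauge (d x u + d u' y) + del.
  apply: gauge_le; rewrite ?addr_ge0 ?metric_ge0// ?(ltW del0)//.
  have := dtri x u y; have := dtri u u' y; lra.
have gst := gaugeD_le (metric_ge0 x u) (metric_ge0 u' y).
have t1 := cost_triangle x u y Gg; have t2 := cost_triangle u u' y Gg.
have big : k < gauge (d x u) * gauge (d u' y).
  have -> : k = ((1 - c1) / 2) * ((1 - c2) / 2) by rewrite /k; field.
  by apply: ltr_pM => //; rewrite divr_ge0// subr_ge0 ltW.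
have small1 : k / (4 * D) * d x u + k / (4 * D) * d u' y <= k / 4.
  rewrite -mulrDr; apply: (@le_trans _ _ (k / (4 * D) * D)).
    by rewrite ler_pM2l ?lerD// divr_gt0// mulr_gt0.
  by rewrite le_eqVlt; apply/orP; left; apply/eqP; field; rewrite gt_eqF.
have small2 : C * del + del = k / 4.
  by rewrite /del; field; rewrite gt_eqF.
by move=> {p21}; lra.
Qed.

End Strict.
End OffDiagonal.

(** * Duality *)

Section Duality.
Context {R : realType} {M : Type} (d : M -> M -> R) (hmetric : is_metric d).
Context {K : ptopologicalType} (iota : Mt M -> K) (hK : is_stone_cech d iota).
Context (mu : {measure set (BorelT K) -> \bar R}).
Hypotheses (hmu : radon mu) (hmin : prec_minimal d iota mu).

Let cK : compact [set: K]. Proof. by case: hK. Qed.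
Let hausK : hausdorff_space K. Proof. by case: hK. Qed.
Let mufin : (mu setT < +oo)%E. Proof. by case: hmu. Qed.
Let I (f : K -> R) : R := \int[mu]_x f x.

Let le_I (f g : K -> R) : continuous f -> continuous g -> (forall x, f x <= g x) ->
  I f <= I g.
Proof.
by move=> cf cg fg; apply: le_Rintegral => //; exact: (cts_integrable cK mufin).
Qed.

Let ID (f g : K -> R) : continuous f -> continuous g ->
  I (fun x => f x + g x) = I f + I g.
Proof.
by move=> cf cg; rewrite /I RintegralD//; exact: (cts_integrable cK mufin).
Qed.

Let IZ a (f : K -> R) : continuous f -> I (fun x => a * f x) = a * I f.
Proof. by move=> cf; rewrite /I RintegralZl//; exact: (cts_integrable cK mufin). Qed.

Definition dominating (f : K -> R) : set R :=
  [set I g | g in [set g | in_G d iota g /\ forall x, f x <= g x]].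

Definition envelope (f : K -> R) : R := inf (dominating f).

Let dominating_nonempty (f : K -> R) : continuous f -> dominating f !=set0.
Proof.
move=> cf; have [B B0 fB] := cts_bounded cK cf.
exists (I (fun=> B)), (fun=> B) => //; split; first by apply: in_G_cst => //; exact: ltW.
by move=> x; exact: le_trans (ler_norm _) (fB x).
Qed.

Let dominating_lb (f : K -> R) : continuous f -> has_lbound (dominating f).
Proof. by move=> cf; exists (I f) => _ [g [[cg _] fg] <-]; exact: le_I. Qed.

Let envelope_le (f g : K -> R) : continuous f -> in_G d iota g ->
  (forall x, f x <= g x) -> envelope f <= I g.
Proof.
by move=> cf Gg fg; apply: ge_inf; [exact: dominating_lb|exists g].
Qed.

(** Holds because [G] is a convex cone and the integral is linear. *)
Let sublinear_envelope : sublinear_on (@cts R K) envelope.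
Proof.
apply: (sublinear_on_inf (@cts_lin_closed R K)).
- by move=> f cf; exact: dominating_nonempty.
- by move=> f cf; exact: dominating_lb.
- move=> f g _ _ cf cg [f' [Gf ff] <-] [g' [Gg gg] <-].
  exists (I f' + I g') => //; exists (fun x => f' x + g' x).
    split; first exact: in_GD.
    by move=> x; exact: lerD.
  by rewrite ID//; [exact: Gf.1|exact: Gg.1].
- move=> f k _ cf k0 [f' [Gf ff] <-].
  exists (k * I f') => //; exists (fun x => k * f' x).
    split; first exact: in_GZ.
    by move=> x; exact: ler_wpM2l.
  by rewrite IZ//; exact: Gf.1.
Qed.

(* Positive measures below [mu] are exactly the linear functionals below
   [envelope]; Hahn-Banach provides one realizing [envelope (- g)]. *)
Lemma minimal_approx (g : K -> R) (e : R) : in_G d iota g -> 0 < e ->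
  exists h, [/\ in_G d iota h, (forall x, 0 <= h x + g x) &
    \int[mu]_x (h x + g x) < e].
Proof.
move=> Gg e0; have cg := Gg.1.
have cNg : @cts R K (fun x => - g x).
  by move=> x; apply: (@continuousN R R^o K g x); exact: cg.
have [Lam [Llin Lle Lg]] := hahn_banach (@cts_lin_closed R K) sublinear_envelope cNg.
have LN (f : K -> R) : continuous f -> Lam (fun x => - f x) = - Lam f.
  move=> cf; have := Llin.2 (-1) f cf; rewrite mulN1r => <-; congr Lam.
  by apply/funext => x; exact: esym (mulN1r (f x)).
(* For [f >= 0] the zero function lies in [G] and dominates [- f], so [Lam (- f) <= 0]. *)
have Lpos (f : K -> R) : continuous f -> (forall x, 0 <= f x) -> 0 <= Lam f.
  move=> cf f0; rewrite -oppr_le0 -LN//.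
  have cNf : @cts R K (fun x => - f x).
    by move=> x; apply: (@continuousN R R^o K f x); exact: cf.
  apply: le_trans (Lle _ cNf) _.
  have := @envelope_le (fun x => - f x) (fun=> 0) cNf (in_G_cst hmetric iota (lexx 0)).
  rewrite /I Rintegral_cst// mul0r; apply => x; by rewrite oppr_le0.
have [nu [rnu nuE]] := riesz_representation cK hausK Llin Lpos.
(* A function of [G] dominates itself, so its envelope is at most its integral against [mu]. *)
have numu : mprec d iota nu mu.
  move=> h Gh; rewrite (RintegralE cK rnu.1 Gh.1) (RintegralE cK mufin Gh.1).
  rewrite lee_fin nuE; last exact: Gh.1.
  apply: le_trans (Lle _ Gh.1) _; apply: envelope_le => //; exact: Gh.1.
(* Minimality gives [I g <= Lam g = - envelope (- g)], so some dominating [h] has integral below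
   [- I g + e]. *)
have := hmin rnu numu Gg.
rewrite (RintegralE cK rnu.1 cg) (RintegralE cK mufin cg) lee_fin nuE//.
rewrite -[Lam g]opprK -LN// Lg => Ig.
have [||_ [h [Gh gh] <-] hI] := @inf_lt R (dominating (fun x => - g x)) (- I g + e).
- exact: dominating_nonempty.
- by apply: le_lt_trans (_ : _ <= - I g) _; [rewrite lerNr|rewrite ltrDl].
exists h; split=> //; first by move=> x; rewrite -lerBlDr sub0r.
have := ID Gh.1 cg; rewrite /I => ->; move: hI; rewrite /I; lra.
Qed.

(** The integrals of [h n + g] are summable, so the series of these nonnegative functions is finite
    off one null set [N]. Finiteness at both points makes a single [h n] small at [z1] and [z2]
    together. *)
Lemma minimal_approx_ae (g : K -> R) : in_G d iota g ->
  exists2 N : set (BorelT K), measurable N /\ mu N = 0%E &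
    forall z1 z2, ~ N z1 -> ~ N z2 -> forall e : R, 0 < e ->
      exists h, [/\ in_G d iota h, (forall x, 0 <= h x + g x),
        h z1 + g z1 < e & h z2 + g z2 < e].
Proof.
move=> Gg; have cg := Gg.1.
have /choice[h hP] : forall n : nat, exists h, [/\ in_G d iota h,
    (forall x, 0 <= h x + g x) & \int[mu]_x (h x + g x) < 1 / (2 ^ n.+1)%:R].
  by move=> n; apply: minimal_approx => //; rewrite divr_gt0// ltr0n expn_gt0.
pose t n (x : K) : R := h n x + g x.
have ct n : continuous (t n) by apply: ctsD => //; have [[]] := hP n.
have t0 n x : 0 <= t n x by have [_ + _] := hP n; apply.
pose S (x : BorelT K) : \bar R := (\sum_(n <oo) (t n x)%:E)%E.
have mt n : measurable_fun [set: BorelT K] (EFin \o (t n : BorelT K -> R)).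
  by apply/measurable_EFinP; exact: cts_measurable.
have mS : measurable_fun setT S.
  apply: (@ge0_emeasurable_sum _ _ _ setT (fun n (x : BorelT K) => (t n x)%:E) xpredT).
    by move=> n x _ _; rewrite lee_fin.
  by move=> n _; exact: mt.
have S0 x : (0 <= S x)%E by apply: nneseries_ge0 => n _ _; rewrite lee_fin.
have IS : (\int[mu]_x S x < +oo)%E.
  rewrite integral_nneseries//; last by move=> n x _; rewrite lee_fin.
  apply: (@le_lt_trans _ _ 1%:E); last by rewrite ltry.
  apply: le_trans (epsilon_trick0 xpredT ler01).
  apply: lee_nneseries => n _; first by move=> _; apply: integral_ge0 => x _; rewrite lee_fin.
  by rewrite (RintegralE cK mufin (ct n)) lee_fin ltW//; have [] := hP n.
have intS : mu.-integrable setT S.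
  apply/integrableP; split=> //.
  by under eq_integral do rewrite gee0_abs//.
have mN : measurable (S @^-1` [set +oo%E]).
  by rewrite -[_ @^-1` _]setTI; apply: mS => //; exact: emeasurable_set1.
exists (S @^-1` [set +oo%E]).
  split=> //; apply: measure_negligible => //.
  have := integrable_ae measurableT intS; apply: negligibleS => x /= Sx.
  by move=> /(_ Logic.I); rewrite Sx.
move=> z1 z2 N1 N2 e e0; apply: contrapT => none.
have fin z : ~ (S @^-1` [set +oo%E]) z -> exists B : R, S z = B%:E.
  move=> /= Sz; have := S0 z; case: (S z) Sz => [r|//|//] _ _; by exists r.
have [B1 S1] := fin _ N1; have [B2 S2] := fin _ N2.
have big n : e <= t n z1 + t n z2.
  rewrite leNgt; apply/negP => small; apply: none; exists (h n).
  have [Gh h0 _] := hP n; split=> //.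
    by apply: le_lt_trans small; rewrite lerDl t0.
  by apply: le_lt_trans small; rewrite lerDr t0.
have part n z B : S z = B%:E -> \sum_(i < n) t i z <= B.
  move=> SB; rewrite -lee_fin -SB -sumEFin -(big_mkord xpredT (fun i => (t i z)%:E)).
  by apply: nneseries_lim_ge => i _ _; rewrite lee_fin.
(* If every term [t i z1 + t i z2] were at least [e], this many of them would exceed the total
   [B1 + B2]. *)
pose n := (Num.truncn ((B1 + B2) / e)).+1.
have : n%:R * e <= B1 + B2.
  apply: le_trans (lerD (part n z1 _ S1) (part n z2 _ S2)).
  rewrite -big_split/= mulr_natl -[n in e *+ n]card_ord -sumr_const.
  exact: ler_sum.
rewrite -ler_pdivlMr// leNgt => /negP; apply; exact: truncnS_gt.
Qed.

End Duality.

(** Choose compact [C n] inside [A] missing less than [1 / (n + 1)] of its mass; the complement of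
    the union lies in the complement of each [C n]. *)
Lemma radon_sigma_compact (R : realType) (K : ptopologicalType)
    (mu : {measure set (BorelT K) -> \bar R}) (A : set (BorelT K)) :
  hausdorff_space K -> radon mu -> measurable A -> mu (~` A) = 0%E ->
  exists C : (set K)^nat, [/\ forall n, compact (C n), forall n, C n `<=` A &
    mu (~` \bigcup_n C n) = 0%E].
Proof.
move=> hausK [fin inner] mA A0.
have decomp B : measurable B -> mu setT = (mu B + mu (~` B))%E.
  move=> mB; have := measureU mu mB (measurableC mB) (setICr B).
  by rewrite setUv.
have muA : mu A = mu setT.
  by rewrite (decomp _ mA) A0 adde0.
have finA : mu A \is a fin_num by rewrite ge0_fin_numE// muA.
have /choice[C CP] : forall n : nat, exists C, [/\ compact C, C `<=` A &
    (mu A - (n.+1%:R^-1)%:E < mu C)%E].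
  move=> n; have n0 : 0 < n.+1%:R^-1 :> R by rewrite invr_gt0 ltr0n.
  have := inner A mA => muE.
  have fs : ereal_sup [set mu C | C in [set C | compact C /\ C `<=` A]] \is a fin_num.
    by rewrite -muE.
  have [_ [C [cC CA] <-]] := ub_ereal_sup_adherent n0 fs.
  by rewrite -muE => hC; exists C.
have mC n : measurable (C n : set (BorelT K)).
  rewrite -[C n]setCK; apply: measurableC; apply: sub_sigma_algebra.
  by apply: closed_openC; apply: compact_closed => //; have [] := CP n.
exists C; split=> [n|n|]; [by have [] := CP n|by have [] := CP n|].
apply/eqP; rewrite eq_le measure_ge0 andbT; apply/lee_addgt0Pr => e e0.
rewrite add0e.
pose n := Num.truncn (e^-1).
apply: (@le_trans _ _ (mu (~` C n))).
  apply: le_measure; rewrite ?inE; [|exact: measurableC|].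
    by apply: measurableC; exact: bigcup_measurable.
  by apply: subsetC; exact: bigcup_sup.
have [_ _] := CP n.
have finC : mu (C n) \is a fin_num.
  rewrite ge0_fin_numE//; apply: le_lt_trans fin.
  by apply: le_measure; rewrite ?inE.
have finC' : mu (~` C n) \is a fin_num.
  rewrite ge0_fin_numE//; apply: le_lt_trans fin.
  by apply: le_measure; rewrite ?inE//; exact: measurableC.
have -> : mu A = (mu (C n) + mu (~` C n))%E.
  by rewrite muA -decomp.
move: finC finC'; case: (mu (C n)) => [a _|//|//]; case: (mu (~` C n)) => [b _|//|//].
move=> hn; have {}hn : a + b - n.+1%:R^-1 < a by rewrite -lte_fin; exact: hn.
rewrite lee_fin.
apply: (@le_trans _ _ n.+1%:R^-1).
  by move: hn; rewrite ltrBlDr ltrD2l => /ltW.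
by rewrite invf_ple ?posrE ?ltr0n//; apply: ltW; exact: truncnS_gt.
Qed.

(** * Mutual singularity of the marginals *)

Unset Implicit Arguments.

Theorem theorem4p9 (R : realType) (M : Type) (d : M -> M -> R) (x0 : M)
  (hmetric : is_metric d) (hcomplete : complete_metric d)
  (h3 : exists a b c : M, [/\ a <> b, b <> c & a <> c])
  (K : ptopologicalType) (iota : Mt M -> K) (hK : is_stone_cech d iota)
  (L : ptopologicalType) (j : M -> L) (hL : is_samuel d j)
  (p1 p2 : K -> L) (hp1 : continuous p1) (hp2 : continuous p2)
  (hp1e : forall z : Mt M, p1 (iota z) = j (proj1_sig z).1)
  (hp2e : forall z : Mt M, p2 (iota z) = j (proj1_sig z).2)
  (d0 : L -> \bar R) (hd0 : continuous d0)
  (hd0e : forall x : M, d0 (j x) = (d x x0)%:E)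
  (mu : {measure set (BorelT K) -> \bar R})
  (hmu : radon mu) (hmin : prec_minimal d iota mu)
  (hconc : mu (~` Rplus p1 p2 d0) = 0%E) :
  mutually_singular (pushforward mu (p1 : BorelT K -> BorelT L))
                    (pushforward mu (p2 : BorelT K -> BorelT L)).
Proof.
have [cK hausK _ _ _] := hK; have [cL hausL _ _ _] := hL.
have [g0 [cg0 g0E]] := exists_strict hmetric hK.
have Gg0 := in_G_strict hmetric cg0 g0E.
have [N [mN N0] approx] := minimal_approx_ae hmetric hK hmu hmin Gg0.
have open_preimage (T : topologicalType) (f : K -> T) (U : set T) :
    continuous f -> open U -> open (f @^-1` U).
  by move=> cf oU; apply: open_comp => // x _; exact: cf.
have finite_open (p : K -> L) : continuous p -> open [set z | RM d0 (p z)].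
  move=> cp; apply: (open_preimage _ (d0 \o p) [set y | (y < +oo)%E]).
    by move=> x; apply: continuous_comp; [exact: cp|exact: hd0].
  exact: open_ereal_lt_ereal.
(* Openness makes the set Borel: finiteness of [d0] is an open condition, and so is [p1 z <> p2 z]
   since [L] is Hausdorff. *)
have oR : open (Rplus p1 p2 d0).
  apply: openI; first exact: finite_open.
  apply: openI; first exact: finite_open.
  rewrite openE => z /= /eqP pz.
  have := hausL; rewrite open_hausdorff.
  move=> /(_ _ _ pz) [[U V] /= [zU zV] [oU oV /eqP UV]].
  rewrite !inE in zU zV.
  rewrite /interior; apply: filterS (filterI
    (open_nbhs_nbhs (conj (open_preimage _ _ _ hp1 oU) zU))
    (open_nbhs_nbhs (conj (open_preimage _ _ _ hp2 oV) zV))).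
  move=> x [/= Ux Vx] px; have : (U `&` V) (p1 x) by split=> //; rewrite px.
  by rewrite UV.
have mR : measurable (Rplus p1 p2 d0 : set (BorelT K)) by exact: sub_sigma_algebra.
pose A : set (BorelT K) := Rplus p1 p2 d0 `&` ~` N.
have mA : measurable A by apply: measurableI => //; exact: measurableC.
have A0 : mu (~` A) = 0%E.
  rewrite /A setCI setCK; apply: null_set_setU => //; exact: measurableC.
have [C [cC CA C0]] := radon_sigma_compact hausK hmu mA A0.
have p12 z1 z2 : A z1 -> A z2 -> p2 z1 <> p1 z2.
  move=> [[f1 [f1' n1]] N1] [[f2 [f2' n2]] N2] p21.
  apply: (no_transfer_point hmetric hK h3 cg0 g0E hL hp1 hp2 hp1e hp2e _ _ p21).
  - by rewrite (strict_gt0 hmetric hK cg0 g0E hp1 hp2 hp1e hp2e hd0 hd0e f1 f1')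
      (strict_lt1 hmetric hK cg0 g0E hL hp1 hp2 hp1e hp2e n1).
  - by rewrite (strict_gt0 hmetric hK cg0 g0E hp1 hp2 hp1e hp2e hd0 hd0e f2 f2')
      (strict_lt1 hmetric hK cg0 g0E hL hp1 hp2 hp1e hp2e n2).
  - exact: approx N1 N2.
have closed_borel (X : ptopologicalType) (F : set X) :
    closed F -> measurable (F : set (BorelT X)).
  move=> cF; rewrite -[F]setCK; apply: measurableC; apply: sub_sigma_algebra.
  exact: closed_openC.
have cpC n : closed (p1 @` C n).
  apply: compact_closed => //; apply: continuous_compact (cC n).
  exact: continuous_subspaceT.
(* The image of [A] itself need not be Borel; the images of the compact [C n] are closed. *)
pose S : set (BorelT L) := \bigcup_n (p1 @` C n).
have mS : measurable S by apply: bigcup_measurable => n _; exact: closed_borel.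
have preS (p : K -> L) : continuous p -> measurable (p @^-1` S : set (BorelT K)).
  move=> cp; rewrite /S preimage_bigcup; apply: bigcup_measurable => n _.
  by apply: closed_borel; apply: closed_comp => // x _; exact: cp.
have mC : measurable (~` \bigcup_n C n : set (BorelT K)).
  apply: measurableC; apply: bigcup_measurable => n _.
  by apply: closed_borel; exact: compact_closed.
have null (B : set (BorelT K)) : measurable B -> B `<=` ~` (\bigcup_n C n) -> mu B = 0%E.
  by move=> mB BC; exact: subset_measure0 mB mC BC C0.
(* Points of the [C n] are sent into [S] by [p1], and outside [S] by [p2] because of [p12]; both
   preimages therefore miss the union of the [C n], which has full measure. *)
exists (~` S); split; first exact: measurableC.
- rewrite /pushforward; apply: null.
    by rewrite preimage_setC; apply: measurableC; exact: preS.
  by move=> z /= nS [n _ Cz]; apply: nS; exists n => //; exists z.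
- rewrite /pushforward setCK; apply: null; first exact: preS.
  move=> z [n _ [z' Cz' /esym pz]] [m _ Cz].
  exact: p12 (CA _ _ Cz) (CA _ _ Cz') pz.
Qed.
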